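(* (i) Let $\varepsilon$ be an integrable scalar random variable with $\mathbb{E}\varepsilon=0$. For $s\in\mathbb{R}$ define $$b(s):=\mathbb{E}[s+\varepsilon]_+-[s]_+ .$$ Then $b(s)=\dfrac{\mathbb{E}|s+\varepsilon|-|s|}{2}$, $b(s)\ge 0$, and $b(s)=0$ if and only if the following condition on the pair $(s,\varepsilon)$ holds: $$(\ast)\qquad \begin{cases} s+\varepsilon\ge 0 \text{ almost surely}, & \text{if } s>0,\\ s+\varepsilon\le 0\text{ almost surely}, & \text{if } s<0,\\ \varepsilon=0 \text{ almost surely}, & \text{if } s=0.\end{cases}$$ (ii) In the vector constraint setting described in the context (exact derivatives and unbiased constraint observations), let $(x_*,u_* )\in\mathcal{Z}^\star$ and set $s_*:=u_*+\rho c(x_* )$. Then $(x_*,u_* )$ is an equilibrium of the mean vector field $\bar F$, i.e. $\bar F(x_*,u_* )=0$, if and only if condition $(\ast)$ holds for every pair $(s_{*,i},\varepsilon_i)$, $i=1,\dots,m$, where $\varepsilon_i=\rho\epsilon_i$ and $\epsilon=(\epsilon_1,\dots,\epsilon_m)$ has the error distribution at the state $(x_*,u_* )$.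
   Context: Notation: for a scalar $t$, $[t]_+:=\max\{t,0\}$; for a vector it is applied componentwise. $\mathbb{R}_+^m$ is the nonnegative orthant. Setting: $n,m$ are positive integers, $f:\mathbb{R}^n\to\mathbb{R}$ and $c:\mathbb{R}^n\to\mathbb{R}^m$ are differentiable, and $J_c(x)\in\mathbb{R}^{m\times n}$ is the Jacobian of $c$. The problem is to minimize $f(x)$ subject to the componentwise inequalities $c(x)\le 0$. Its KKT set is $$\mathcal{Z}^\star:=\{(x,u)\in\mathbb{R}^n\times\mathbb{R}^m:\ \nabla f(x)+J_c(x)^\top u=0,\ c(x)\le 0,\ u\ge 0,\ \langle u,c(x)\rangle=0\}.$$ Fix scalars $\rho>0$ and $\kappa>0$. At each state $(x,u)\in\mathbb{R}^n\times\mathbb{R}_+^m$ the constraint observation is $\widehat c:=c(x)+\epsilon$, where $\epsilon\in\mathbb{R}^m$ is an integrable random vector with $\mathbb{E}\epsilon=0$ whose distribution may depend on the state $(x,u)$; its components need not be independent. All expectations are at the fixed state. The directly sampled multiplier signal is $\widehat\lambda:=[u+\rho\widehat c]_+=[u+\rho c(x)+\rho\epsilon]_+$, and the mean vector field is $$\bar F(x,u):=\begin{pmatrix}-\nabla f(x)-J_c(x)^\top\mathbb{E}\widehat\lambda\\ \kappa(\mathbb{E}\widehat\lambda-u)\end{pmatrix}.$$ *)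

(* Defs.v *)
From HB Require Import structures.
From mathcomp Require Export all_boot all_order all_algebra.
From mathcomp Require Export all_classical all_reals all_analysis.
Export Order.TTheory GRing.Theory Num.Theory numFieldNormedType.Exports.

Set Implicit Arguments.
Unset Strict Implicit.
Unset Printing Implicit Defensive.

Local Open Scope classical_set_scope.
Local Open Scope ring_scope.

(* Vectors of R^n are row vectors 'rV[R]_n, because the library's Jacobian is
   only defined for maps between spaces of row vectors. *)

Definition pos (R : realType) (t : R) : R := Num.max t 0.

Definition posv (R : realType) (m : nat) (v : 'rV[R]_m) : 'rV[R]_m :=
  map_mx (@pos R) v.

Definition dot (R : realType) (m : nat) (u v : 'rV[R]_m) : R :=
  \sum_(i < m) u ord0 i * v ord0 i.

Definition gradient (R : realType) (n : nat) (f : 'rV[R]_n -> R)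
    (x : 'rV[R]_n) : 'rV[R]_n :=
  \row_(j < n) 'D_(delta_mx ord0 j) f x.

(* The library's ['J c x] acts on row vectors by [h |-> h *m 'J c x], so it has
   size n x m and is the transpose of the Jacobian in the usual convention:
   [Jac c x i j] is the partial derivative of the i-th component of [c] in the
   j-th coordinate. *)
Definition Jac (R : realType) (n m : nat) (c : 'rV[R]_n -> 'rV[R]_m)
    (x : 'rV[R]_n) : 'M[R]_(m, n) :=
  ('J c x)^T.

(* [u *m Jac c x] is the row vector form of J_c(x)^T u. *)
Definition KKT (R : realType) (n m : nat) (f : 'rV[R]_n -> R)
    (c : 'rV[R]_n -> 'rV[R]_m) : set ('rV[R]_n * 'rV[R]_m) :=
  [set z | [/\ gradient f z.1 + z.2 *m Jac c z.1 = 0,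
               forall i, c z.1 ord0 i <= 0,
               forall i, 0 <= z.2 ord0 i &
               dot z.2 (c z.1) = 0]].

Section probability.
Context {d : measure_display} {T : measurableType d} {R : realType}.
Variable P : probability T R.

(* The library's expectation is extended-real valued; this is its real value,
   meaningful for integrable X. *)
Definition mean (X : T -> R) : R := fine ('E_P[X])%E.

(* Integrability of each component includes its measurability. *)
Definition integrable_vec (m : nat) (X : T -> 'rV[R]_m) : Prop :=
  forall i : 'I_m, P.-integrable setT (fun w => (X w ord0 i)%:E).

Definition mean_vec (m : nat) (X : T -> 'rV[R]_m) : 'rV[R]_m :=
  \row_(i < m) mean (fun w => X w ord0 i).

Definition bias (e : T -> R) (s : R) : R :=
  mean (fun w => pos (s + e w)) - pos s.

Definition no_crossing (s : R) (e : T -> R) : Prop :=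
  [/\ 0 < s -> {ae P, forall w, 0 <= s + e w},
      s < 0 -> {ae P, forall w, s + e w <= 0} &
      s = 0 -> {ae P, forall w, e w = 0}].

End probability.

(* Both the probability measure [P x u] and the error vector [eps x u] may
   depend on the state, so the error laws at the states are arbitrary. *)
Section mean_field.
Context {d : measure_display} {T : measurableType d} {R : realType}.
Variables (n m : nat) (f : 'rV[R]_n -> R) (c : 'rV[R]_n -> 'rV[R]_m).
Variables (rho kappa : R).
Variable P : 'rV[R]_n -> 'rV[R]_m -> probability T R.
Variable eps : 'rV[R]_n -> 'rV[R]_m -> T -> 'rV[R]_m.

Definition c_hat (x : 'rV[R]_n) (u : 'rV[R]_m) (w : T) : 'rV[R]_m :=
  c x + eps x u w.

Definition lambda_hat (x : 'rV[R]_n) (u : 'rV[R]_m) (w : T) : 'rV[R]_m :=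
  posv (u + rho *: c_hat x u w).

Definition Fbar (x : 'rV[R]_n) (u : 'rV[R]_m) : 'rV[R]_(n + m) :=
  let lambda := mean_vec (P x u) (lambda_hat x u) in
  row_mx (- gradient f x - lambda *m Jac c x) (kappa *: (lambda - u)).

End mean_field.

(* Main.v *)
Require Import Defs.
From mathcomp Require Import ring lra.

(** Write [[t]_+ = (t + |t|) / 2].  As the error has mean zero, the linear half
    contributes nothing to the bias, so
    [b(s) = (E|s + e| - |s|) / 2] ([bias_abs]).  The sign [sg s] is a
    subgradient of [|.|] at [s] with [sg s * s = |s|]; since
    [E(s + e) = s], subtracting [sg s * (s + e)] inside the expectation turns
    the formula into
    [2 b(s) = E(|s + e| - sg s * (s + e))] ([bias_sign_gap]),
    whose integrand is nonnegative.  Hence [b(s) >= 0], with equality exactly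
    when [|s + e| = sg s * (s + e)] almost surely.  For [s > 0], [s < 0] and
    [s = 0] this equation says [s + e >= 0], [s + e <= 0] and [s + e = 0]
    ([sign_gap_eq0]).  Taking the middle subgradient [0] of [|.|] at [s = 0]
    is what makes the three cases uniform.

    For the mean field, complementarity is the fixed point equation
    [u = [u + rho c(x)]_+] at a KKT point ([pos_complementarity]), so the
    [i]-th component of [E lambda_hat - u] is exactly the bias of
    [rho eps_i] at [s_i].  The multiplier block of [Fbar] vanishes if and only
    if [E lambda_hat = u], and then stationarity makes the primal block
    vanish as well ([Fbar_eq0]). *)

Set Implicit Arguments.
Unset Strict Implicit.
Unset Printing Implicit Defensive.

Local Open Scope classical_set_scope.
Local Open Scope ring_scope.

(** * Positive part and sign gap *)

Lemma posE (R : realType) (t : R) : pos t = 2^-1 * (t + `|t|).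
Proof.
rewrite /pos; have [t0|t0] := leP t 0.
  by rewrite ler0_norm// subrr mulr0.
by rewrite gtr0_norm//; field.
Qed.

(** One of [u] and [c] vanishes: if [u = 0], the positive part kills
    [rho * c <= 0]; if [c = 0], it leaves [u >= 0] unchanged. *)
Lemma pos_complementarity (R : realType) (u c rho : R) :
  0 < rho -> 0 <= u -> c <= 0 -> u * c = 0 -> pos (u + rho * c) = u.
Proof.
move=> rho0 u0 c0 /eqP; rewrite mulf_eq0 => /orP[]/eqP E; rewrite E /pos.
  by rewrite add0r max_r// mulr_ge0_le0// ltW.
by rewrite mulr0 addr0 max_l.
Qed.

(** The excess of [|.|] at [t] over its tangent (of slope [0] when [s = 0])
    at [s]. *)
Definition sign_gap (R : realType) (s t : R) : R := `|t| - Num.sg s * t.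

Lemma sign_gap_ge0 (R : realType) (s t : R) : 0 <= sign_gap s t.
Proof.
rewrite /sign_gap subr_ge0 (le_trans (ler_norm _))// normrM.
by rewrite ler_piMl// normr_sg; case: eqP.
Qed.

Lemma sign_gap_eq0 (R : realType) (s t : R) :
  sign_gap s t = 0 <->
  [/\ 0 < s -> 0 <= t, s < 0 -> t <= 0 & s = 0 -> t = 0].
Proof.
rewrite /sign_gap; case: (ltgtP s 0) => [s0|s0|->].
- rewrite ltr0_sg// mulN1r opprK; split=> [h|[_ h _]].
    by have := normr_ge0 t; split=> [|_|]; lra.
  by rewrite ler0_norm ?h// addNr.
- rewrite gtr0_sg// mul1r; split=> [h|[h _ _]].
    by have := normr_ge0 t; split=> [_||]; lra.
  by rewrite ger0_norm ?h// subrr.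
- rewrite sgr0 mul0r subr0.
  split=> [/normr0_eq0 ->|[_ _ ->//]]; last by rewrite normr0.
  by split; rewrite // ltxx.
Qed.

(** * Real-valued means *)

Section mean_theory.
Context {d : measure_display} {T : measurableType d} {R : realType}.
Variable P : probability T R.
Implicit Types X Y : T -> R.

Lemma meanE X : mean P X = (\int[P]_w X w)%R.
Proof. by rewrite /mean unlock. Qed.

Lemma mean_cst k : mean P (fun=> k) = k.
Proof.
rewrite meanE (Rintegral_cst _ measurableT).
by rewrite [X in fine X]probability_setT mulr1.
Qed.

Lemma meanD X Y : P.-integrable setT (EFin \o X) ->
  P.-integrable setT (EFin \o Y) ->
  mean P (fun w => X w + Y w) = mean P X + mean P Y.
Proof. by move=> iX iY; rewrite !meanE RintegralD. Qed.

Lemma meanZl k X : P.-integrable setT (EFin \o X) ->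
  mean P (fun w => k * X w) = k * mean P X.
Proof. by move=> iX; rewrite !meanE RintegralZl. Qed.

Lemma mean_ge0 X : (forall w, 0 <= X w) -> 0 <= mean P X.
Proof. by move=> X0; rewrite meanE Rintegral_ge0. Qed.

Lemma integrable_shift X k : P.-integrable setT (EFin \o X) ->
  P.-integrable setT (EFin \o (fun w => k + X w)).
Proof.
move=> iX.
have ik := finite_measure_integrable_cst P k measurableT.
exact: eq_integrable (integrableD _ ik iX).
Qed.

Lemma integrable_scale X k : P.-integrable setT (EFin \o X) ->
  P.-integrable setT (EFin \o (fun w => k * X w)).
Proof. by move=> iX; apply: eq_integrable (integrableZl _ k iX). Qed.

Lemma mean_eq0 X : P.-integrable setT (EFin \o X) -> (forall w, 0 <= X w) ->
  mean P X = 0 <-> {ae P, forall w, X w = 0}.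
Proof.
move=> iX X0; have /integrableP[mX _] := iX.
have <- : (\int[P]_w `|(X w)%:E| = 0)%E <-> mean P X = 0.
  rewrite (eq_integral (EFin \o X)); last first.
    by move=> w _; rewrite gee0_abs ?lee_fin.
  rewrite meanE /Rintegral.
  split=> [->//|E].
  by rewrite -[LHS]fineK ?E// integrable_fin_num.
rewrite (ae_eq_integral_abs P measurableT mX); split; apply: filterS => w.
  by move=> /(_ I)[].
by move=> /= ->.
Qed.

(** * Bias of the positive part *)

Section bias_theory.
Variable e : T -> R.
Hypothesis ie : P.-integrable setT (EFin \o e).
Hypothesis e0 : mean P e = 0.
Variable s : R.

Let ise : P.-integrable setT (EFin \o (fun w => s + e w)).
Proof. exact: integrable_shift. Qed.

Let iabs : P.-integrable setT (EFin \o (fun w => `|s + e w|)).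
Proof. exact: integrable_norm ise. Qed.

Let mean_shift : mean P (fun w => s + e w) = s.
Proof.
rewrite meanD//; first by rewrite mean_cst e0 addr0.
exact: finite_measure_integrable_cst.
Qed.

Lemma bias_abs : bias P e s = (mean P (fun w => `|s + e w|) - `|s|) / 2.
Proof.
rewrite /bias (_ : (fun w => pos _) =
    (fun w => 2^-1 * ((s + e w) + `|s + e w|))); last first.
  by apply/funext => w; rewrite posE.
rewrite meanZl; last exact: eq_integrable (integrableD _ ise iabs).
by rewrite meanD// mean_shift posE; field.
Qed.

Let igap : P.-integrable setT (EFin \o (fun w => sign_gap s (s + e w))).
Proof.
exact: eq_integrable (integrableB _ iabs (integrable_scale (Num.sg s) ise)).
Qed.

(** [E (sg s * (s + e)) = sg s * s = |s|], so the subtracted tangent term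
    accounts exactly for the term [- |s|] of [bias_abs], and the bias becomes
    the mean of a single nonnegative variable. *)
Lemma bias_sign_gap : bias P e s = mean P (fun w => sign_gap s (s + e w)) / 2.
Proof.
rewrite bias_abs (_ : (fun w => sign_gap _ _) =
    (fun w => `|s + e w| + - Num.sg s * (s + e w))); last first.
  by apply/funext => w; rewrite /sign_gap mulNr.
rewrite meanD//; last exact: integrable_scale.
by rewrite meanZl// mean_shift mulNr -normrEsg.
Qed.

Lemma bias_ge0 : 0 <= bias P e s.
Proof.
by rewrite bias_sign_gap divr_ge0// mean_ge0// => w; exact: sign_gap_ge0.
Qed.

Lemma bias_eq0 : bias P e s = 0 <-> no_crossing P s e.
Proof.
have -> : bias P e s = 0 <-> mean P (fun w => sign_gap s (s + e w)) = 0.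
  by rewrite bias_sign_gap; split=> [|->]; lra.
rewrite mean_eq0//; last by move=> w; exact: sign_gap_ge0.
split=> [ae0|[hp hn hz]].
  split=> s0; apply: filterS ae0 => w /sign_gap_eq0[gp gn gz].
  - exact: gp.
  - exact: gn.
  - by have := gz s0; rewrite s0 add0r.
case: (ltgtP s 0) => s0.
- apply: filterS (hn s0) => w h; apply/sign_gap_eq0.
  by split=> // s1; lra.
- apply: filterS (hp s0) => w h; apply/sign_gap_eq0.
  by split=> // s1; lra.
- apply: filterS (hz s0) => w h; apply/sign_gap_eq0.
  by rewrite s0 h addr0 ltxx.
Qed.

End bias_theory.
End mean_theory.

(** * Equilibria of the mean field *)

Lemma KKT_complementarity (R : realType) (n m : nat) (f : 'rV[R]_n -> R)
    (c : 'rV[R]_n -> 'rV[R]_m) x u :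
  KKT f c (x, u) -> forall i, u ord0 i * c x ord0 i = 0.
Proof.
move=> [/= _ c0 u0 uc] i; apply/eqP; rewrite -oppr_eq0; apply/eqP.
(* all terms of the vanishing inner product have the same sign *)
apply: (psumr_eq0P (P := predT) (F := fun j => - (u ord0 j * c x ord0 j))) => //.
  by move=> j _; rewrite oppr_ge0 mulr_ge0_le0.
by rewrite sumrN [X in - X]uc oppr0.
Qed.

(** The multiplier block alone decides: once it forces the mean signal to be
    [u], the primal block is the negative of the stationarity residual. *)
Lemma Fbar_eq0 (d : measure_display) (T : measurableType d) (R : realType)
    (n m : nat) (f : 'rV[R]_n -> R) (c : 'rV[R]_n -> 'rV[R]_m) (rho kappa : R)
    (P : 'rV[R]_n -> 'rV[R]_m -> probability T R)
    (eps : 'rV[R]_n -> 'rV[R]_m -> T -> 'rV[R]_m) x u :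
  kappa != 0 -> gradient f x + u *m Jac c x = 0 ->
  Fbar f c rho kappa P eps x u = 0 <->
  mean_vec (P x u) (lambda_hat c rho eps x u) = u.
Proof.
move=> kappa0 stat; rewrite /Fbar /=; split=> [|->].
  rewrite -row_mx0 => /eq_row_mx[_ /eqP].
  by rewrite scaler_eq0 (negbTE kappa0) subr_eq0 => /eqP.
by rewrite -opprD stat oppr0 subrr scaler0 row_mx0.
Qed.

Theorem proposition4p1 (R : realType) (d : measure_display)
    (T : measurableType d) :
  (forall (P : probability T R) (e : {RV P >-> R}),
      P.-integrable setT (EFin \o e) ->
      mean P e = 0 ->
      forall s : R,
        [/\ bias P e s = (mean P (fun w => `|s + e w|) - `|s|) / 2,
            0 <= bias P e s &
            bias P e s = 0 <-> no_crossing P s e])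
  /\
  (forall (n m : nat) (f : 'rV[R]_n -> R) (c : 'rV[R]_n -> 'rV[R]_m)
      (rho kappa : R)
      (P : 'rV[R]_n -> 'rV[R]_m -> probability T R)
      (eps : 'rV[R]_n -> 'rV[R]_m -> T -> 'rV[R]_m),
      (0 < n)%N -> (0 < m)%N ->
      (forall x, differentiable f x) ->
      (forall x, differentiable c x) ->
      0 < rho -> 0 < kappa ->
      (forall (x : 'rV[R]_n) (u : 'rV[R]_m), (forall i, 0 <= u ord0 i) ->
         integrable_vec (P x u) (eps x u) /\
         mean_vec (P x u) (eps x u) = 0) ->
      forall (xs : 'rV[R]_n) (us : 'rV[R]_m),
        KKT f c (xs, us) ->
        let ss := us + rho *: c xs in
        Fbar f c rho kappa P eps xs us = 0 <->
        (forall i : 'I_m,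
           no_crossing (P xs us) (ss ord0 i)
             (fun w => rho * eps xs us w ord0 i))).
Proof.
split=> [P e ie e0 s|].
  by split; [exact: bias_abs|exact: bias_ge0|exact: bias_eq0].
move=> n m f c rho kappa P eps _ _ _ _ rho0 kappa0 noise xs us kkt ss.
have [/= stat c0 u0 _] := kkt; have [ieps eps0] := noise xs us u0.
pose e i w := rho * eps xs us w ord0 i.
have ie i : (P xs us).-integrable setT (EFin \o e i).
  exact: integrable_scale (ieps i).
have e0 i : mean (P xs us) (e i) = 0.
  rewrite meanZl; last exact: ieps.
  by have /rowP/(_ i) := eps0; rewrite !mxE => ->; rewrite mulr0.
have lambdaE i : mean_vec (P xs us) (lambda_hat c rho eps xs us) ord0 i
    - us ord0 i = bias (P xs us) (e i) (ss ord0 i).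
  rewrite /bias {2}/ss !mxE (pos_complementarity rho0)//; last first.
    exact: (KKT_complementarity kkt).
  congr (mean _ _ - _); apply/funext => w.
  by rewrite !mxE mulrDr addrA.
rewrite Fbar_eq0 ?gt_eqF//; split=> [lambda_us i|nc].
  by apply/(bias_eq0 (ie i) (e0 i)); rewrite -lambdaE lambda_us subrr.
apply/rowP => i; apply/eqP; rewrite -subr_eq0 lambdaE; apply/eqP.
exact/(bias_eq0 (ie i) (e0 i)).
Qed.
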